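(* Let $(X,d)$ be a separable metric space admitting a weak convergence, and let $p\ge 1$. Suppose that $\{\mu_n\}_{n\in\mathbb{N}}$ and $\mu$ in $\mathcal{P}_{p-1}(X)$ satisfy $\mu_n\to\mu$ in $\tau_{\mathrm{w}}^{p-1}$, and suppose that non-negative real numbers $\{\varepsilon_n\}_{n\in\mathbb{N}}$ satisfy $\varepsilon_n\to 0$. Then, for any sequence $\{x_n\}_{n\in\mathbb{N}}$ in $X$ with $x_n\in M_p(\mu_n;\varepsilon_n)$ for all $n\in\mathbb{N}$, the sequence $\{x_n\}_{n\in\mathbb{N}}$ is relatively $d$-compact (every subsequence has a further subsequence converging in $d$) and any $d$-subsequential limit of it lies in $M_p(\mu)$.
   Context: A convergence $c$ on a set $X$ is a rule assigning at most one point of $X$ as the ''limit'' of each sequence in $X$, such that whenever a sequence has limit $x$, every subsequence also has limit $x$; we write $x_n\to x$ in $c$. A convergence $w$ on $X$ is a weak convergence for the metric space $(X,d)$ if: (W1) whenever $\{x_n\}$ and $y$ in $X$ satisfy $\sup_n d(x_n,y)<\infty$, there are a subsequence $\{n_k\}$ and $x\in X$ with $x_{n_k}\to x$ in $w$; (W2) whenever $x_n\to x$ in $w$, then $d(x,y)\le\liminf_n d(x_n,y)$ for all $y\in X$; (W3) whenever $x_n\to x$ in $w$ and $d(x_n,y)\to d(x,y)$ for some $y\in X$, then $d(x_n,x)\to 0$. $(X,d)$ admits a weak convergence if such a $w$ exists. For $r\ge 0$, $\mathcal{P}_r(X)$ is the set of Borel probability measures $\mu$ on $(X,d)$ with $\int_X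 d^r(x,y)\,d\mu(y)<\infty$ for some (equivalently all) $x\in X$. We write $\mu_n\to\mu$ in $\tau_{\mathrm{w}}^{r}$ if $\int f\,d\mu_n\to\int f\,d\mu$ for every bounded continuous $f:(X,d)\to\mathbb{R}$ and $\int_X d^r(x,y)\,d\mu_n(y)\to\int_X d^r(x,y)\,d\mu(y)$ for all $x\in X$. For $p\ge1$ and $\mu\in\mathcal{P}_{p-1}(X)$ define $W_p(\mu,x,x'):=\int_X (d^p(x,y)-d^p(x',y))\,d\mu(y)$ (well defined), and for $\varepsilon\ge0$ define $M_p(\mu;\varepsilon):=\{x\in X: W_p(\mu,x,x')\le\varepsilon \text{ for all } x'\in X\}$ and the Fréchet $p$-mean set $M_p(\mu):=M_p(\mu;0)$. *)

(* Defs.v *)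
From HB Require Import structures.
From mathcomp Require Import all_boot all_order all_algebra.
From mathcomp Require Import all_classical all_reals all_analysis.
Set Implicit Arguments. Unset Strict Implicit. Unset Printing Implicit Defensive.
Import Order.TTheory GRing.Theory Num.Theory.
Import numFieldNormedType.Exports.
Local Open Scope classical_set_scope.
Local Open Scope ring_scope.

Section Defs.
Context {R : realType} {X : Type}.
Variable dist : X -> X -> R.

Definition is_metric : Prop :=
  [/\ forall x y, 0 <= dist x y,
      forall x y, dist x y = 0 <-> x = y,
      forall x y, dist x y = dist y x &
      forall x y z, dist x z <= dist x y + dist y z].

Definition dopen (A : set X) : Prop :=
  forall x, A x -> exists2 r : R, 0 < r & forall y, dist x y < r -> A y.

Definition separable : Prop :=
  exists D : set X, countable D /\
    forall x (e : R), 0 < e -> exists2 z, D z & dist x z < e.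

Definition dconv (s : nat -> X) (x : X) : Prop :=
  (fun n => dist (s n) x) @ \oo --> (0 : R).

Definition strict_incr (phi : nat -> nat) : Prop :=
  forall m n, (m < n)%N -> (phi m < phi n)%N.

Definition is_convergence (c : (nat -> X) -> X -> Prop) : Prop :=
  (forall s x y, c s x -> c s y -> x = y) /\
  (forall s x phi, c s x -> strict_incr phi -> c (s \o phi) x).

Definition is_weak_convergence (w : (nat -> X) -> X -> Prop) : Prop :=
  [/\ is_convergence w,
      (forall (s : nat -> X) (y : X),
         (exists M : R, forall n, dist (s n) y <= M) ->
         exists phi x, strict_incr phi /\ w (s \o phi) x),
      (forall s x, w s x -> forall y,
         ((dist x y)%:E <= limn_einf (fun n => (dist (s n) y)%:E))%E) &
      (forall s x, w s x -> forall y,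
         (fun n => dist (s n) y) @ \oo --> dist x y ->
         (fun n => dist (s n) x) @ \oo --> (0 : R))].

Definition admits_weak_convergence : Prop :=
  exists w, is_weak_convergence w.

Definition dcontinuous (f : X -> R) : Prop :=
  forall x (e : R), 0 < e -> exists2 delta : R, 0 < delta &
    forall y, dist x y < delta -> `|f x - f y| < e.

Definition bounded_fun (f : X -> R) : Prop :=
  exists M : R, forall x, `|f x| <= M.

End Defs.

Section Measures.
Context {R : realType} {dm : measure_display} {X : measurableType dm}.
Variable dist : X -> X -> R.

Definition borel_of_metric : Prop :=
  (@measurable dm X) = <<s [set A | dopen dist A] >>.

Definition in_Pr (r : R) (mu : probability X R) : Prop :=
  forall x, (\int[mu]_y ((dist x y) `^ r)%:E < +oo)%E.

Definition tau_w_conv (r : R) (mun : nat -> probability X R)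
  (mu : probability X R) : Prop :=
  (forall f : X -> R, dcontinuous dist f -> bounded_fun f ->
     (fun n => \int[mun n]_y f y) @ \oo --> \int[mu]_y f y) /\
  (forall x, (fun n => \int[mun n]_y (dist x y) `^ r) @ \oo -->
              \int[mu]_y (dist x y) `^ r).

Definition Wp (p : R) (mu : probability X R) (x x' : X) : R :=
  \int[mu]_y ((dist x y) `^ p - (dist x' y) `^ p).

Definition Mp_eps (p : R) (mu : probability X R) (eps : R) : set X :=
  [set x | forall x', Wp p mu x x' <= eps].

Definition Mp (p : R) (mu : probability X R) : set X := Mp_eps p mu 0.

End Measures.

(* Main.v *)
(* Let [L] be the pointwise limit of [L_m y = inf_(n >= m) d(x_n, y)]. For fixed
   [m] and [x'], the function [L_m ^ p - d(x', -) ^ p] is continuous, grows at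
   most like [d ^ (p - 1)] and lies below [d(x_n, -) ^ p - d(x', -) ^ p] for
   [n >= m], so its [mu_n]-integrals converge to its [mu]-integral, which is thus
   at most [lim eps_n = 0]. Letting [m] grow, the integral of
   [L ^ p - d(x', -) ^ p] against [mu] is nonpositive for every [x'].
   If [x_n -> x] in [d], then [L = d(x, -)] and [x] is a Frechet mean. If
   [x_n -> x] only weakly, take [x' = x]: the integrand cannot be positive
   everywhere, so [liminf d(x_n, y) <= d(x, y)] for some [y]; by (W2) a
   subsequence satisfies [d(x_n, y) -> d(x, y)], and (W3) gives [x_n -> x] in [d].
   The sequence is bounded because comparing [x_n] with a base point [o] bounds
   [eps_n] below by about [d(x_n, o)] times the [mu_n]-mass of a large ball, up
   to a tail of [d ^ (p - 1)] and a constant. *)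
Require Import Defs.
From HB Require Import structures.
From mathcomp Require Import all_boot all_order all_algebra.
From mathcomp Require Import all_classical all_reals all_analysis.
From mathcomp Require Import measurable_realfun ring lra.
Import Order.TTheory GRing.Theory Num.Theory.
Import numFieldNormedType.Exports.
Local Open Scope classical_set_scope.
Local Open Scope ring_scope.

(** * Inequalities and continuity for real powers *)

Section PowerInequalities.
Context {R : realType}.
Implicit Types a b p r t rho K M : R.

(** The tangent of the convex function [t ^ p] at [a], from Young's inequality for [a ^ (p - 1)] and
    [b] with the conjugate exponents [p / (p - 1)] and [p]. At [p = 1] the first exponent
    degenerates, hence the separate case. *)
Lemma powR_tangent a b p : 1 <= p -> 0 <= a -> 0 <= b ->
  p * a `^ (p - 1) * (b - a) <= b `^ p - a `^ p.
Proof.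
move=> p1 a0 b0; have p0 : 0 < p by lra.
have [->|pn1] := eqVneq p 1; first by rewrite subrr powRr0 !powRr1 //; lra.
have pgt1 : 1 < p by rewrite lt_neqAle eq_sym pn1.
have q0 : 0 < p / (p - 1) by rewrite divr_gt0 // subr_gt0.
have pq : (p / (p - 1))^-1 + p^-1 = 1 by field; lra.
have := conjugate_powR (powR_ge0 a (p - 1)) b0 q0 p0 pq.
rewrite -powRrM [(p - 1) * _](_ : _ = p); last by field; lra.
rewrite -(mulr_powRB1 a0 p0).
set A := a `^ _; set B := b `^ p => h.
have : p * (A * b) <= p * (a * A / (p / (p - 1)) + B / p) by rewrite ler_pM2l.
have -> : p * (a * A / (p / (p - 1)) + B / p) = (p - 1) * (a * A) + B.
  by field; lra.
lra.
Qed.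

Lemma powR_add_le a b r : 0 <= r -> 0 <= a -> 0 <= b ->
  (a + b) `^ r <= 2 `^ r * (a `^ r + b `^ r).
Proof.
move=> r0 a0 b0; rewrite mulrDr -!powRM //.
have [ab|ba] := leP a b.
  apply: (@le_trans _ _ ((2 * b) `^ r)); last by rewrite lerDr powR_ge0.
  by apply: ge0_ler_powR => //; rewrite ?nnegrE; lra.
apply: (@le_trans _ _ ((2 * a) `^ r)); last by rewrite lerDl powR_ge0.
by apply: ge0_ler_powR => //; rewrite ?nnegrE; lra.
Qed.

(** The tangent inequalities at [a] and at [b] bound the difference from both sides, and
    [b <= a + M] eliminates [b]. The growth in [a] thereby drops from order [p] to order [p - 1],
    the moment that is available. *)
Lemma powR_sub_le a b p M : 1 <= p -> 0 <= a -> 0 <= b -> `|b - a| <= M ->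
  `|b `^ p - a `^ p| <=
  p * M * 2 `^ (p - 1) * M `^ (p - 1) + p * M * (2 `^ (p - 1) + 1) * a `^ (p - 1).
Proof.
move=> p1 a0 b0 hM; have M0 : 0 <= M by rewrite (le_trans _ hM).
have t1 := powR_tangent a b p p1 a0 b0.
have t2 := powR_tangent b a p p1 b0 a0.
have bM : b `^ (p - 1) <= 2 `^ (p - 1) * (a `^ (p - 1) + M `^ (p - 1)).
  apply: le_trans (powR_add_le _ _ _ _ _ _) => //; last by lra.
  apply: ge0_ler_powR; rewrite ?nnegrE; try lra.
  by move: hM; rewrite ler_norml; lra.
have A0 := powR_ge0 a (p - 1); have B0 := powR_ge0 b (p - 1).
have C0 := powR_ge0 2 (p - 1); have D0 := powR_ge0 M (p - 1).
move: t1 t2 bM A0 B0 C0 D0.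
set A := a `^ (p - 1); set B := b `^ (p - 1); set C := 2 `^ (p - 1).
set D := M `^ (p - 1) => t1 t2 bM A0 B0 C0 D0.
have p0 : 0 <= p by lra.
have pM : 0 <= p * M by rewrite mulr_ge0.
have /andP[h1 h2] : - M <= b - a <= M by rewrite -ler_norml.
have s1 : p * M * B <= p * M * (C * (A + D)) by rewrite ler_wpM2l.
have s2 : p * A * (- M) <= p * A * (b - a) by rewrite ler_wpM2l ?mulr_ge0.
have s3 : p * B * (- M) <= p * B * (a - b).
  by rewrite ler_wpM2l ?mulr_ge0 //; lra.
have s4 : 0 <= p * M * A by rewrite mulr_ge0.
have s5 : 0 <= p * M * (C * (A + D)) by rewrite !mulr_ge0 ?addr_ge0.
by rewrite ler_norml; lra.
Qed.

(** The absolute value gives a function continuous on the whole line, ready for composition. At [0]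
    the radius [e ^ (1 / r)] works; elsewhere the power is differentiable. *)
Lemma continuous_norm_powR r : 0 <= r -> continuous (fun z : R => `|z| `^ r).
Proof.
rewrite le_eqVlt => /orP[/eqP <-|r0] z.
  by under eq_fun do rewrite powRr0; exact: cvg_cst.
have [->|z0] := eqVneq z 0.
  rewrite /continuous_at normr0 powR0 ?gt_eqF //.
  apply/cvgrPdist_lt => e e0.
  have h : 0 < e `^ r^-1 by rewrite powR_gt0.
  have /cvgrPdist_lt /(_ _ h) : (fun x : R => x) @ 0 --> (0 : R) by exact: cvg_id.
  apply: filterS => x; rewrite !sub0r !normrN => xe.
  rewrite ger0_norm ?powR_ge0 // [ltRHS](_ : e = (e `^ r^-1) `^ r).
    by apply: gt0_ltr_powR => //; rewrite ?nnegrE ?powR_ge0.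
  by rewrite -powRrM mulVf ?gt_eqF // powRr1 // ltW.
apply: (@cvg_comp _ _ _ Num.norm (fun t : R => t `^ r) _ (nbhs `|z|)).
  exact: norm_continuous.
have : {for `|z|, continuous (fun t : R => t `^ r)}; last exact.
apply: differentiable_continuous; apply/derivable1_diffP.
by apply: derivable_powR; rewrite in_itv /= andbT normr_gt0.
Qed.

(* When [t < K] the difference is at least [rho - C]; for arbitrary [t] it is at
   least [- p * t `^ (p - 1) * rho]. The bound interpolates with weight
   [min (t / K) 1], so that it is continuous in [t]. *)
Lemma powR_sub_ge b t rho K p : 1 <= p -> 0 <= b -> 0 <= t -> 0 < K ->
  0 <= rho -> t - b <= rho -> rho <= b + t ->
  rho * (1 - Num.min (t / K) 1 - p * Num.min (t / K) 1 * t `^ (p - 1))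
    - (K + 1 + K `^ p) <= b `^ p - t `^ p.
Proof.
move=> p1 b0 t0 K0 rho0 h1 h2; set c := Num.min _ _.
have p0 : 0 <= p := le_trans ler01 p1.
have t1 := powR_tangent t b p p1 t0 b0.
have A0 := powR_ge0 t (p - 1).
have KP0 := powR_ge0 K p.
have c0 : 0 <= c by rewrite le_min ler01 andbT divr_ge0 // ltW.
have c1 : c <= 1 by rewrite ge_min lexx orbT.
have s1 : p * t `^ (p - 1) * - rho <= p * t `^ (p - 1) * (b - t).
  by rewrite ler_wpM2l ?mulr_ge0 //; lra.
have [Kt|tK] := leP K t.
  have -> : c = 1 by apply/min_idPr; rewrite ler_pdivlMr // mul1r.
  by lra.
(* Since [t < K], [rho <= b + t] gives [rho - K < b], and [b - 1 <= b ^ p] replaces [b] by its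
   power. *)
have s2 : rho - (K + 1 + K `^ p) <= b `^ p - t `^ p.
  have : t `^ p <= K `^ p by apply: ge0_ler_powR; rewrite ?nnegrE //; lra.
  have : b - 1 <= b `^ p.
    have [b1|b1] := leP 1 b; first by have := le1r_powR b1 p1; lra.
    by have := powR_ge0 b p; lra.
  by lra.
set A := t `^ (p - 1) in t1 A0 s1 *; set C := K + 1 + _ in s2 *.
have C0 : 0 <= C by rewrite /C; lra.
set D := b `^ p - t `^ p in s2 t1 *.
have s3 : (1 - c) * (rho - C) <= (1 - c) * D by rewrite ler_wpM2l // subr_ge0.
have s4 : c * (p * A * - rho) <= c * D.
  by rewrite ler_wpM2l //; exact: le_trans s1 t1.
have s5 : 0 <= c * C by rewrite mulr_ge0.
lra.
Qed.

End PowerInequalities.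

(** * Continuity with respect to [dist] *)

Section MetricContinuity.
Context {R : realType} {X : Type} (dist : X -> X -> R).
Implicit Types f g : X -> R.

(** [X] carries no topology; this filter of balls turns [dcontinuous] into a limit, so that the
    usual algebra of limits applies. *)
Definition metric_nbhs (x : X) : set_system X :=
  filter_from [set r : R | 0 < r] (fun r => [set y | dist x y < r]).

Global Instance metric_nbhs_filter x : Filter (metric_nbhs x).
Proof.
apply: filter_from_filter; first by exists 1 => /=.
move=> r s /= r0 s0; exists (Num.min r s); first by rewrite /= lt_min r0.
by move=> y /=; rewrite lt_min => /andP[].
Qed.

Lemma dcontinuousP f :
  dcontinuous dist f <-> forall x, f @ metric_nbhs x --> f x.
Proof.
split=> [cf x|cf x e e0].
  apply/cvgrPdist_lt => e e0; have [r r0 h] := cf x e e0.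
  by exists r.
have /cvgrPdist_lt /(_ _ e0)[r r0 h] := cf x.
by exists r => // y /h.
Qed.

Lemma dcontinuous_cst (c : R) : dcontinuous dist (fun=> c).
Proof. by apply/dcontinuousP => x; exact: cvg_cst. Qed.

Lemma dcontinuousD f g : dcontinuous dist f -> dcontinuous dist g ->
  dcontinuous dist (fun x => f x + g x).
Proof.
move=> /dcontinuousP cf /dcontinuousP cg; apply/dcontinuousP => x.
exact: (cvgD (cf x) (cg x)).
Qed.

Lemma dcontinuousB f g : dcontinuous dist f -> dcontinuous dist g ->
  dcontinuous dist (fun x => f x - g x).
Proof.
move=> /dcontinuousP cf /dcontinuousP cg; apply/dcontinuousP => x.
exact: (cvgB (cf x) (cg x)).
Qed.

Lemma dcontinuousM f g : dcontinuous dist f -> dcontinuous dist g ->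
  dcontinuous dist (fun x => f x * g x).
Proof.
move=> /dcontinuousP cf /dcontinuousP cg; apply/dcontinuousP => x.
exact: (cvgM (cf x) (cg x)).
Qed.

Lemma dcontinuous_comp (h : R -> R) f : continuous h -> dcontinuous dist f ->
  dcontinuous dist (h \o f).
Proof.
move=> ch /dcontinuousP cf; apply/dcontinuousP => x.
exact: (cvg_comp _ _ (cf x) (ch (f x))).
Qed.

Lemma dcontinuous_lipschitz f :
  (forall x y, `|f x - f y| <= dist x y) -> dcontinuous dist f.
Proof.
by move=> hf x e e0; exists e => // y; exact: le_lt_trans.
Qed.

Lemma dcontinuous_minr (c : R) f : dcontinuous dist f ->
  dcontinuous dist (fun x => Num.min (f x) c).
Proof.
move=> cf x e e0; have [r r0 h] := cf x e e0; exists r => // y /h.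
apply: le_lt_trans; rewrite /Num.min.
by case: ltP => ?; case: ltP => ?; rewrite !ler_norml;
  case: (ler0P (f x - f y)) => ?; apply/andP; split; lra.
Qed.

Lemma dopen_preimage_gt f c : dcontinuous dist f ->
  dopen dist (f @^-1` `]c, +oo[).
Proof.
move=> cf x /=; rewrite in_itv /= andbT => fx.
have e0 : 0 < f x - c by rewrite subr_gt0.
have [r r0 h] := cf x _ e0; exists r => // y /h.
by rewrite /= in_itv /= andbT ltr_norml => /andP[_]; lra.
Qed.

End MetricContinuity.

(** * Real-valued integrals against probability measures *)

Section Integration.
Context {R : realType} {dm : measure_display} {X : measurableType dm}.
Implicit Types (mu : probability X R) (f g : X -> R).

Lemma cvg_Rintegral_dominated mu (f_ : nat -> X -> R) f g :
  (forall n, measurable_fun setT (f_ n)) -> measurable_fun setT f ->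
  (forall x, f_ n x @[n --> \oo] --> f x) ->
  mu.-integrable setT (EFin \o g) -> (forall n x, `|f_ n x| <= g x) ->
  (\int[mu]_x f_ n x) @[n --> \oo] --> \int[mu]_x f x.
Proof.
move=> mf_ mf cf ig hg.
have [||||If _ cI] := @dominated_convergence _ _ _ mu setT measurableT
  (fun n => EFin \o f_ n) (EFin \o f) (EFin \o g) _ _ _ ig _.
- by move=> n; exact/measurable_EFinP.
- exact/measurable_EFinP.
- by apply: aeW => x _; apply: cvg_EFin; [exact: nearW | exact: cf].
- by apply: aeW => x n _; rewrite lee_fin.
apply: fine_cvg; rewrite fineK //.
by apply: integrable_fin_num.
Qed.

(** A zero integral would make [f] vanish almost everywhere, so a null set would contain the whole
    space, which has mass [1]. *)
Lemma Rintegral_gt0 mu f : (forall x, 0 < f x) ->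
  mu.-integrable setT (EFin \o f) -> 0 < \int[mu]_x f x.
Proof.
move=> f0 If; rewrite lt_neqAle Rintegral_ge0 ?andbT; last first.
  by move=> x _; exact: ltW.
apply/eqP => I0.
have mf := measurable_int _ If.
have E0 : (\int[mu]_x `|(EFin \o f) x| = 0)%E.
  rewrite (eq_integral (EFin \o f)); last first.
    by move=> x _ /=; rewrite gtr0_norm.
  by rewrite -[LHS]fineK ?integrable_fin_num //; congr EFin; rewrite [RHS]I0.
have /(ae_eq_integral_abs mu measurableT mf) [A [mA A0 hA]] := E0.
have : (mu setT <= mu A)%E.
  apply: le_measure; rewrite ?inE // => x _; apply: hA => /= /(_ I).
  by case=> h; have := f0 x; rewrite h ltxx.
by rewrite A0 probability_setT lee_fin ler10.
Qed.

Lemma Rintegral_probability_cst mu (c : R) : \int[mu]_y c = c.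
Proof.
rewrite Rintegral_cst // (_ : fine _ = 1) ?mulr1 //.
by rewrite -[RHS]/(fine 1%E) -(probability_setT mu).
Qed.

End Integration.

(** * Distances and Borel measurability *)

Section MetricMeasure.
Context {R : realType} {dm : measure_display} {X : measurableType dm}.
Context (dist : X -> X -> R).
Context (Hmetric : is_metric dist) (Hborel : borel_of_metric dist).
Implicit Types (mu : probability X R) (f h : X -> R).

Let dist_ge0 x y : 0 <= dist x y. Proof. by case: Hmetric. Qed.

Let distC x y : dist x y = dist y x. Proof. by case: Hmetric. Qed.

Let dist_triangle x y z : dist x z <= dist x y + dist y z.
Proof. by case: Hmetric. Qed.

Lemma dist_lipschitz x y z : `|dist x y - dist x z| <= dist y z.
Proof.
have h1 := dist_triangle x z y; have h2 := dist_triangle x y z.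
by move: h1; rewrite (distC z y) ler_norml; lra.
Qed.

Lemma dist_lipschitzl x x' y : `|dist x y - dist x' y| <= dist x x'.
Proof. by rewrite !(distC _ y) dist_lipschitz. Qed.

Lemma measurable_dcontinuous f : dcontinuous dist f -> measurable_fun setT f.
Proof.
move=> cf; apply: (measurability (@RGenOInfty.G R)).
  exact: RGenOInfty.measurableE.
move=> _ [_ [c ->] <-]; rewrite setTI Hborel.
by apply: sub_sigma_algebra; exact: dopen_preimage_gt.
Qed.

Lemma dcontinuous_dist_powR o (r : R) : 0 <= r ->
  dcontinuous dist (fun y => dist o y `^ r).
Proof.
move=> r0; rewrite (_ : (fun _ => _) = (fun z : R => `|z| `^ r) \o dist o).
  apply: dcontinuous_comp; first exact: continuous_norm_powR.
  by apply: dcontinuous_lipschitz; exact: dist_lipschitz.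
by apply/funext => y /=; rewrite ger0_norm.
Qed.

(** * Convergence of integrals of continuous functions of growth [d ^ r] *)

Section Growth.
Context (r : R).
Context (r0 : 0 <= r).

Definition power_growth (o : X) f :=
  exists C D, forall y, `|f y| <= C + D * dist o y `^ r.

Lemma integrable_dist_powR mu o : in_Pr dist r mu ->
  mu.-integrable setT (fun y => (dist o y `^ r)%:E).
Proof.
move=> hmu; apply/integrableP; split.
  by apply/measurable_EFinP/measurable_dcontinuous/dcontinuous_dist_powR.
rewrite (eq_integral (fun y => (dist o y `^ r)%:E)); first exact: hmu.
by move=> y _; rewrite gee0_abs // lee_fin powR_ge0.
Qed.

Lemma integrable_growth_bound mu o C D : in_Pr dist r mu ->
  mu.-integrable setT (EFin \o (fun y => C + D * dist o y `^ r)).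
Proof.
move=> hmu; rewrite (_ : _ \o _ =
  (fun y => C%:E + D%:E * (dist o y `^ r)%:E)%E); last exact/funext.
apply: integrableD => //; first exact: finite_measure_integrable_cst.
by apply: integrableZl => //; exact: integrable_dist_powR.
Qed.

Lemma integrable_power_growth mu o f : in_Pr dist r mu ->
  dcontinuous dist f -> power_growth o f -> mu.-integrable setT (EFin \o f).
Proof.
move=> hmu cf [C [D hf]].
apply: (le_integrable measurableT _ _ (integrable_growth_bound mu o C D hmu)).
  exact/measurable_EFinP/measurable_dcontinuous.
move=> y _; rewrite /= lee_fin (le_trans (hf y)) //; exact: ler_norm.
Qed.

Context (mun : nat -> probability X R) (mu : probability X R).
Context (Hmun : forall n, in_Pr dist r (mun n)) (Hmu : in_Pr dist r mu).
Context (Hconv : tau_w_conv dist r mun mu).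

(** The truncations [min h k] are bounded and continuous, so their integrals converge; for [k] large
    the truncation costs less than [e / 2] against [mu], and it only lowers the integral against
    [mun n]. *)
Lemma Rintegral_lsc h (e : R) : 0 < e ->
  dcontinuous dist h -> (forall y, 0 <= h y) ->
  mu.-integrable setT (EFin \o h) ->
  (forall n, (mun n).-integrable setT (EFin \o h)) ->
  \forall n \near \oo, \int[mu]_y h y - e < \int[mun n]_y h y.
Proof.
move=> e0 ch h0 Ih Ihn.
pose t k y := Num.min (h y) k%:R.
have ct k : dcontinuous dist (t k) by exact: dcontinuous_minr.
have t0 k y : 0 <= t k y by rewrite le_min h0 ler0n.
have th k y : t k y <= h y by rewrite ge_min lexx.
have It (nu : probability X R) k :
    nu.-integrable setT (EFin \o h) -> nu.-integrable setT (EFin \o t k).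
  move=> Inu; apply: (le_integrable measurableT _ _ Inu).
    exact/measurable_EFinP/measurable_dcontinuous.
  by move=> y _; rewrite /= lee_fin !ger0_norm.
have cvgt : (\int[mu]_y t k y) @[k --> \oo] --> \int[mu]_y h y.
  apply: (cvg_Rintegral_dominated mu t h h) => //.
  - by move=> n; exact: measurable_dcontinuous.
  - exact: measurable_dcontinuous.
  - move=> y; apply: cvg_near_cst; near=> k; rewrite /t; apply/min_idPl.
    by near: k; exact: nbhs_infty_ger.
  - by move=> n y; rewrite ger0_norm.
have e2 : 0 < e / 2 by lra.
have /cvgrPdist_lt /(_ _ e2) [k _ /(_ k (leqnn k)) /= hk] := cvgt.
have bt : Defs.bounded_fun (t k).
  by exists k%:R => y; rewrite ger0_norm // ge_min lexx orbT.
have /cvgrPdist_lt /(_ _ e2) := Hconv.1 _ (ct k) bt.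
apply: filterS => n hn.
have := le_Rintegral measurableT (It _ k (Ihn n)) (Ihn n) (fun y _ => th k y).
by move: hk hn; rewrite !ltr_norml => /andP[? ?] /andP[? ?] ?; lra.
Unshelve. all: by end_near. Qed.

(** The moment part of [tau_w_conv] gives convergence for the envelope [G]. Both [G + f] and [G - f]
    are nonnegative, and lower semicontinuity applied to them bounds the integrals of [f] from below
    and from above. *)
Lemma cvg_Rintegral_power_growth o f :
  dcontinuous dist f -> power_growth o f ->
  (\int[mun n]_y f y) @[n --> \oo] --> \int[mu]_y f y.
Proof.
move=> cf [C [D hf]].
pose G y := C + D * dist o y `^ r.
have cG : dcontinuous dist G.
  apply: dcontinuousD; first exact: dcontinuous_cst.
  by apply: dcontinuousM; [exact: dcontinuous_cst|exact: dcontinuous_dist_powR].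
have fG : power_growth o f by exists C, D.
have IG nu : in_Pr dist r nu -> nu.-integrable setT (EFin \o G).
  exact: integrable_growth_bound.
have If nu (hnu : in_Pr dist r nu) := integrable_power_growth nu o f hnu cf fG.
have IntG (nu : probability X R) : in_Pr dist r nu ->
    \int[nu]_y G y = C + D * \int[nu]_y (dist o y `^ r).
  move=> hnu; rewrite RintegralD //.
  - rewrite RintegralZl //; last exact: integrable_dist_powR.
    by rewrite Rintegral_probability_cst.
  - exact: finite_measure_integrable_cst.
  - rewrite (_ : _ \o _ = (fun y => D%:E * (dist o y `^ r)%:E)%E).
      by apply: integrableZl => //; exact: integrable_dist_powR.
    exact/funext.
have cvgG : (\int[mun n]_y G y) @[n --> \oo] --> \int[mu]_y G y.
  rewrite IntG //; under eq_fun do rewrite IntG //.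
  by apply: cvgD; [exact: cvg_cst|apply: cvgM; [exact: cvg_cst|exact: Hconv.2]].
have hGf y : - G y <= f y <= G y by rewrite -ler_norml; exact: hf.
apply/cvgrPdist_lt => e e0.
have e2 : 0 < e / 2 by lra.
have IDf nu (hnu : in_Pr dist r nu) :
    nu.-integrable setT (EFin \o (fun y => G y + f y)).
  by rewrite (_ : _ \o _ = (EFin \o G) \+ (EFin \o f))%E;
    [apply: integrableD => //; [exact: IG|exact: If]|exact/funext].
have IBf nu (hnu : in_Pr dist r nu) :
    nu.-integrable setT (EFin \o (fun y => G y - f y)).
  by rewrite (_ : _ \o _ = (EFin \o G) \- (EFin \o f))%E;
    [apply: integrableB => //; [exact: IG|exact: If]|exact/funext].
have GDf y : 0 <= G y + f y by have := hGf y; lra.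
have GBf y : 0 <= G y - f y by have := hGf y; lra.
have hD := Rintegral_lsc _ _ e2 (dcontinuousD _ _ _ cG cf) GDf (IDf _ Hmu)
  (fun n => IDf _ (Hmun n)).
have hB := Rintegral_lsc _ _ e2 (dcontinuousB _ _ _ cG cf) GBf (IBf _ Hmu)
  (fun n => IBf _ (Hmun n)).
have /cvgrPdist_lt /(_ _ e2) hG := cvgG.
have rD (nu : probability X R) : in_Pr dist r nu ->
    \int[nu]_y (G y + f y) = \int[nu]_y G y + \int[nu]_y f y.
  by move=> hnu; rewrite RintegralD //; [exact: IG|exact: If].
have rB (nu : probability X R) : in_Pr dist r nu ->
    \int[nu]_y (G y - f y) = \int[nu]_y G y - \int[nu]_y f y.
  by move=> hnu; rewrite RintegralB //; [exact: IG|exact: If].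
apply: filterS3 hG hB hD => n; rewrite !rD // !rB // !ltr_norml.
by move=> /andP[? ?] ? ?; apply/andP; split; lra.
Qed.

End Growth.

(** * Tail infima of the distances along a sequence *)

Section TailInfimum.
Context (s : nat -> X).

(** The function [L_m] of the outline; the real [inf] is genuine, as the set is nonempty and bounded
    below by [0]. *)
Definition tail_inf (m : nat) (y : X) : R :=
  inf [set dist (s n) y | n in [set n | (m <= n)%N]].

Lemma tail_inf_le m n y : (m <= n)%N -> tail_inf m y <= dist (s n) y.
Proof.
move=> mn; apply: ge_inf; last by exists n.
by exists 0 => _ [k _ <-].
Qed.

Lemma le_tail_inf m y (c : R) : (forall n, (m <= n)%N -> c <= dist (s n) y) ->
  c <= tail_inf m y.
Proof.
move=> h; apply: lb_le_inf; first by exists (dist (s m) y), m => /=.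
by move=> _ [n /= mn <-]; exact: h.
Qed.

Lemma tail_inf_homo m n y : (m <= n)%N -> tail_inf m y <= tail_inf n y.
Proof.
move=> mn; apply: le_tail_inf => k nk; apply: tail_inf_le.
exact: leq_trans nk.
Qed.

Lemma tail_inf_dist m x (M : R) y : (forall n, (m <= n)%N -> dist (s n) x <= M) ->
  `|tail_inf m y - dist x y| <= M.
Proof.
move=> hM; have h1 := tail_inf_le m m y (leqnn m).
have h2 : dist x y - M <= tail_inf m y.
  apply: le_tail_inf => n mn; have := hM n mn.
  by have := dist_triangle x (s n) y; rewrite (distC x (s n)); lra.
have := hM m (leqnn m); have := dist_triangle (s m) x y.
by rewrite ler_norml; lra.
Qed.

Lemma tail_inf_lipschitz m y z : `|tail_inf m y - tail_inf m z| <= dist y z.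
Proof.
suff h a b : tail_inf m a - dist a b <= tail_inf m b.
  by have := h y z; have := h z y; rewrite (distC z y) ler_norml; lra.
apply: le_tail_inf => n mn; have := tail_inf_le m n a mn.
by have := dist_triangle (s n) b a; rewrite (distC b a); lra.
Qed.

Lemma is_cvg_tail_inf x (M : R) : (forall n, dist (s n) x <= M) ->
  forall y, cvgn (tail_inf ^~ y).
Proof.
move=> hM y; apply: nondecreasing_is_cvgn.
  by move=> m n; exact: tail_inf_homo.
exists (dist x y + M) => _ [m _ <-].
have := tail_inf_dist m x M y (fun n _ => hM n).
by rewrite ler_norml; lra.
Qed.

End TailInfimum.

(** Past some index all [s n] lie within [e] of [x], so [tail_inf_dist] applies with [M = e]. *)
Lemma tail_inf_cvg s x : dconv dist s x ->
  forall y, tail_inf s m y @[m --> \oo] --> dist x y.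
Proof.
move=> /cvgr0Pnorm_le sx y; apply/cvgrPdist_le => e e0.
have [N _ hN] := sx e e0.
exists N => // m /= Nm; rewrite distrC; apply: tail_inf_dist => n mn.
apply: le_trans (hN n (leq_trans Nm mn)); exact: ler_norm.
Qed.

(* The functions which behave like the distance to a point at distance at most
   [M] from [x]; unlike genuine distances they are stable under tail infima. *)
Definition distance_like (x : X) (M : R) (f : X -> R) : Prop :=
  [/\ forall y, 0 <= f y, forall y z, `|f y - f z| <= dist y z &
      forall y, `|f y - dist x y| <= M].

Lemma distance_like_dist x z M : dist z x <= M -> distance_like x M (dist z).
Proof.
move=> h; split => [y|y y'|y]; first exact: dist_ge0.
- exact: dist_lipschitz.
- exact: le_trans (dist_lipschitzl _ _ _) h.
Qed.

Lemma distance_like_tail_inf s x M m : (forall n, dist (s n) x <= M) ->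
  distance_like x M (tail_inf s m).
Proof.
move=> h; split => [y|y z|y]; first by apply: le_tail_inf => n _; exact: dist_ge0.
- exact: tail_inf_lipschitz.
- exact: tail_inf_dist.
Qed.

Lemma distance_like_cvg x M (f_ : nat -> X -> R) f :
  (forall n, distance_like x M (f_ n)) ->
  (forall y, f_ n y @[n --> \oo] --> f y) -> distance_like x M f.
Proof.
move=> hf cf; split => [y|y z|y].
- by apply: (cvgr_to_ge (cf y)); apply: nearW => n; case: (hf n).
- have c : `|f_ n y - f_ n z| @[n --> \oo] --> `|f y - f z|.
    by apply: cvg_norm; apply: cvgB.
  by apply: (cvgr_to_le c); apply: nearW => n; case: (hf n).
- have c : `|f_ n y - dist x y| @[n --> \oo] --> `|f y - dist x y|.
    by apply: cvg_norm; apply: cvgB; [exact: cf|exact: cvg_cst].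
  by apply: (cvgr_to_le c); apply: nearW => n; case: (hf n).
Qed.

(** * Approximate Frechet means *)

Section FrechetMean.
Context (p : R).
Context (p1 : 1 <= p).

Let p0 : 0 <= p. Proof. exact: le_trans ler01 p1. Qed.

Let q0 : 0 <= p - 1. Proof. by rewrite subr_ge0. Qed.

(** [C] and [D] are chosen before [f], so that one function dominates all tail infima at once. *)
Lemma distance_like_growth x M : 0 <= M ->
  exists C D, forall f, distance_like x M f ->
    forall y, `|f y `^ p - dist x y `^ p| <= C + D * dist x y `^ (p - 1).
Proof.
move=> M0; eexists; eexists => f [f0 _ hf] y.
exact: (powR_sub_le _ _ _ M).
Qed.

Lemma distance_like_dcontinuous x M f : distance_like x M f ->
  dcontinuous dist (fun y => f y `^ p - dist x y `^ p).
Proof.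
move=> [f0 lf _]; apply: dcontinuousB; last first.
  exact: dcontinuous_dist_powR.
rewrite (_ : (fun _ => _) = (fun z : R => `|z| `^ p) \o f).
  apply: dcontinuous_comp; first exact: continuous_norm_powR.
  exact: dcontinuous_lipschitz.
by apply/funext => y /=; rewrite ger0_norm.
Qed.

Lemma distance_like_power_growth x M f : 0 <= M -> distance_like x M f ->
  power_growth (p - 1) x (fun y => f y `^ p - dist x y `^ p).
Proof.
move=> M0 hf; have [C [D h]] := distance_like_growth x M M0.
by exists C, D; exact: h.
Qed.

Lemma distance_like_integrable mu x M f : in_Pr dist (p - 1) mu ->
  0 <= M -> distance_like x M f ->
  mu.-integrable setT (EFin \o (fun y => f y `^ p - dist x y `^ p)).
Proof.
move=> hmu M0 hf; apply: (integrable_power_growth (p - 1) q0 _ x) => //.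
- exact: distance_like_dcontinuous hf.
- exact: distance_like_power_growth hf.
Qed.

Context (mun : nat -> probability X R) (mu : probability X R).
Context (Hmun : forall n, in_Pr dist (p - 1) (mun n))
  (Hmu : in_Pr dist (p - 1) mu) (Hconv : tau_w_conv dist (p - 1) mun mu).
Context (eps : nat -> R) (s : nat -> X).
Context (Heps : eps @ \oo --> (0 : R))
  (Hs : forall n, Mp_eps dist p (mun n) (eps n) (s n)).

(** The key inequality, with [x] as comparison point. The limit [f] is left general: it is [dist z]
    when the sequence converges to [z] in [d], and the lower limit of the distances otherwise. *)
Lemma Rintegral_tail_inf_le0 x M f : (forall n, dist (s n) x <= M) ->
  (forall y, tail_inf s m y @[m --> \oo] --> f y) ->
  \int[mu]_y (f y `^ p - dist x y `^ p) <= 0.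
Proof.
move=> hM cf; have M0 : 0 <= M := le_trans (dist_ge0 _ _) (hM 0%N).
have dt m := distance_like_tail_inf s x M m hM.
have df := distance_like_cvg _ _ _ _ dt cf.
have [C [D hG]] := distance_like_growth x M M0.
have cpow (u : nat -> R) (l : R) : (forall n, 0 <= u n) -> 0 <= l ->
    u n @[n --> \oo] --> l -> u n `^ p @[n --> \oo] --> l `^ p.
  move=> u0 l0 ul.
  have := cvg_comp _ _ ul (continuous_norm_powR p p0 l).
  rewrite /comp ger0_norm //.
  by apply: cvg_trans; apply: near_eq_cvg; apply: nearW => n /=; rewrite ger0_norm.
have cI : (\int[mu]_y (tail_inf s m y `^ p - dist x y `^ p)) @[m --> \oo] -->
    \int[mu]_y (f y `^ p - dist x y `^ p).
  apply: (cvg_Rintegral_dominated mu _ _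
    (fun y => C + D * dist x y `^ (p - 1))).
  - move=> m; apply: measurable_dcontinuous.
    exact: distance_like_dcontinuous (dt m).
  - by apply: measurable_dcontinuous; exact: distance_like_dcontinuous df.
  - move=> y; apply: cvgB; last exact: cvg_cst.
    apply: cpow => //; last by case: df.
    by move=> m; case: (dt m).
  - exact: integrable_growth_bound.
  - by move=> m y; apply: hG.
(* The limit in [m] comes last: it remains to treat each fixed [m] by letting [n] grow. *)
apply: (cvgr_to_le cI); apply: nearW => m.
have cn := cvg_Rintegral_power_growth (p - 1) q0 mun mu Hmun Hmu Hconv x _
  (distance_like_dcontinuous _ _ _ (dt m))
  (distance_like_power_growth _ _ _ M0 (dt m)).
(* For [n >= m] the tail infimum lies below the distance to [s n], so its integral is at most [Wp]
   at [s n] and [x], hence at most [eps n]. *)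
apply: (ler_cvg_to cn Heps); exists m => // n /= mn.
apply: le_trans (Hs n x); rewrite /Wp.
apply: le_Rintegral => //.
- exact: distance_like_integrable (dt m).
- exact: distance_like_integrable (distance_like_dist _ _ _ (hM n)).
move=> y _; apply: lerB => //; apply: ge0_ler_powR; rewrite ?nnegrE //.
- by case: (dt m).
- exact: tail_inf_le.
Qed.

Lemma dist_bounded o : exists M, forall n, dist (s n) o <= M.
Proof.
(* The weight of [powR_sub_ge] for [t = dist o y] and [K = k + 1], which is positive for every [k].
   The coefficient of [rho] there is [h k], a continuous stand-in for the indicator of a large ball
   minus a tail. *)
pose c k y : R := Num.min (dist o y / k.+1%:R) 1.
pose h k y := 1 - c k y - p * c k y * dist o y `^ (p - 1).
have c0 k y : 0 <= c k y by rewrite le_min ler01 andbT divr_ge0.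
have c1 k y : c k y <= 1 by rewrite ge_min lexx orbT.
have t0 y : 0 <= p * dist o y `^ (p - 1) by rewrite mulr_ge0 // powR_ge0.
have ch k : dcontinuous dist (h k).
  have cc : dcontinuous dist (c k).
    apply: dcontinuous_minr; apply: dcontinuousM; last exact: dcontinuous_cst.
    by apply: dcontinuous_lipschitz; exact: dist_lipschitz.
  apply: dcontinuousB.
    by apply: dcontinuousB => //; exact: dcontinuous_cst.
  apply: dcontinuousM; last exact: dcontinuous_dist_powR.
  by apply: dcontinuousM => //; exact: dcontinuous_cst.
have hb k y : `|h k y| <= 1 + p * dist o y `^ (p - 1).
  have : c k y * (p * dist o y `^ (p - 1)) <= 1 * (p * dist o y `^ (p - 1)).
    exact: ler_wpM2r.
  have : 0 <= c k y * (p * dist o y `^ (p - 1)) by rewrite mulr_ge0.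
  have := c0 k y; have := c1 k y; have := t0 y.
  by rewrite /h ler_norml; lra.
have gh k : power_growth (p - 1) o (h k) by exists 1, p; exact: hb.
have Ih nu k (hnu : in_Pr dist (p - 1) nu) :=
  integrable_power_growth (p - 1) q0 nu o (h k) hnu (ch k) (gh k).
(* The weights tend to [0] pointwise like [1 / (k + 1)], so [h k] tends to [1] under an integrable
   envelope. *)
have cmu : (\int[mu]_y h k y) @[k --> \oo] --> (1 : R).
  rewrite -[X in _ --> X](Rintegral_probability_cst mu).
  apply: (cvg_Rintegral_dominated mu h (cst 1)
      (fun y => 1 + p * dist o y `^ (p - 1))) => //.
  - by move=> k; exact: measurable_dcontinuous.
  - move=> y; set B := dist o y * (1 + p * dist o y `^ (p - 1)).
    apply: (@squeeze_cvgr _ _ _ _ (fun k => 1 - harmonic k * B) (cst 1)).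
    + apply: nearW => k.
      have ck : c k y <= dist o y / k.+1%:R by rewrite ge_min lexx.
      have := ler_wpM2r (addr_ge0 ler01 (t0 y)) ck.
      have := mulr_ge0 (c0 k y) (t0 y); have := c0 k y.
      rewrite /h /B /=; set d := k.+1%:R^-1; set A := dist o y `^ (p - 1).
      set e := c k y; set t := dist o y => ? ? ?.
      by apply/andP; split; lra.
    + rewrite -[X in _ --> X]subr0; apply: cvgB; first exact: cvg_cst.
      rewrite -(mul0r B); apply: cvgM; last exact: cvg_cst.
      exact: cvg_harmonic.
    + exact: cvg_cst.
  - exact: integrable_growth_bound.
have h2 : (2^-1 : R) < 1 by lra.
have [k _ /(_ k (leqnn k)) /= hk] := cvgr_gt _ cmu _ h2.
pose C : R := k.+1%:R + 1 + k.+1%:R `^ p.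
have C0 : 0 <= C by rewrite !addr_ge0 // powR_ge0.
have cn := cvg_Rintegral_power_growth (p - 1) q0 mun mu Hmun Hmu Hconv o _
  (ch k) (gh k).
(* Integrating [powR_sub_ge] bounds [rho / 2] by [Wp + C], hence by [eps n + C]. *)
have key n : 2^-1 < \int[mun n]_y h k y -> eps n < 1 ->
    dist (s n) o <= 2 * (C + 1).
  move=> hn en; set rho := dist (s n) o.
  have rho0 : 0 <= rho by exact: dist_ge0.
  have Irh : (mun n).-integrable setT (EFin \o (fun y => rho * h k y)).
    rewrite (_ : _ \o _ = (fun y => rho%:E * (h k y)%:E)%E); last exact/funext.
    by apply: integrableZl => //; exact: Ih.
  have IC : (mun n).-integrable setT (EFin \o (fun=> C)).
    exact: finite_measure_integrable_cst.
  have I1 : \int[mun n]_y (rho * h k y - C) = rho * \int[mun n]_y h k y - C.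
    rewrite RintegralB // RintegralZl //; last exact: Ih.
    by rewrite Rintegral_probability_cst.
  have I2 : \int[mun n]_y (rho * h k y - C) <= Wp dist p (mun n) (s n) o.
    apply: le_Rintegral => //.
    - pose g y := rho * h k y.
      rewrite (_ : _ \o _ = (EFin \o g) \- (EFin \o cst C))%E.
        exact: integrableB.
      exact/funext.
    - exact: (distance_like_integrable _ o rho _ (Hmun n) rho0
        (distance_like_dist _ _ _ (lexx rho))).
    - move=> y _; apply: powR_sub_ge => //.
      + by rewrite lerBlDr /rho (distC (s n) o); exact: dist_triangle.
      + by rewrite (distC o y); exact: dist_triangle.
  rewrite I1 in I2; rewrite -ler_pdivrMl // mulrC.
  apply: (@le_trans _ _ (rho * \int[mun n]_y h k y)).
    by rewrite ler_wpM2l // ltW.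
  rewrite addrC -lerBlDr (le_trans I2) // (le_trans (Hs n o)) //; exact: ltW.
have [N _ hN] : \forall n \near \oo, dist (s n) o <= 2 * (C + 1).
  near=> n; apply: key; near: n; first exact: cvgr_gt _ cn _ hk.
  exact: cvgr_lt _ Heps _ (ltr01 : (0 : R) < 1).
(* The sum covers the finitely many indices below [N]. *)
exists (2 * (C + 1) + \sum_(i < N) dist (s i) o) => n.
have [Nn|nN] := leqP N n.
  by apply: le_trans (hN n Nn) _; rewrite lerDl sumr_ge0.
rewrite (bigD1 (Ordinal nN)) //=.
have : 0 <= \sum_(i < N | i != Ordinal nN) dist (s i) o by rewrite sumr_ge0.
by lra.
Unshelve. all: by end_near. Qed.

(** The conclusion spells out that the lower limit [f y] of the distances is at most [dist x y].
    Were this false for every [y], the integral of [f ^ p - d(x, -) ^ p] would be positive, against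
    [Rintegral_tail_inf_le0]. *)
Lemma liminf_dist_attained x : exists y, forall N (e : R), 0 < e ->
  exists2 n, (N <= n)%N & dist (s n) y < dist x y + e.
Proof.
have [M hM] := dist_bounded x.
pose f y := limn (tail_inf s ^~ y).
have cf y : tail_inf s m y @[m --> \oo] --> f y by exact: is_cvg_tail_inf hM y.
have df := distance_like_cvg _ _ _ _
  (fun m => distance_like_tail_inf s x M m hM) cf.
have [y fy] : exists y, f y <= dist x y.
  apply: contrapT => /forallNP nf.
  have M0 : 0 <= M := le_trans (dist_ge0 _ _) (hM 0%N).
  have := Rintegral_tail_inf_le0 x M f hM cf; apply/negP; rewrite -ltNge.
  apply: Rintegral_gt0; last exact: distance_like_integrable df.
  move=> y; rewrite subr_gt0; apply: gt0_ltr_powR; rewrite ?nnegrE //.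
  - exact: lt_le_trans ltr01 p1.
  - by case: df.
  - by rewrite ltNge; apply/negP; exact: nf.
exists y => N e e0; apply: contrapT => nex.
have : dist x y + e <= tail_inf s N y.
  apply: le_tail_inf => n Nn; rewrite leNgt; apply/negP => h.
  by apply: nex; exists n.
have : tail_inf s N y <= f y.
  apply: (cvgr_to_ge (cf y)); exists N => // m; exact: tail_inf_homo.
lra.
Qed.

End FrechetMean.
End MetricMeasure.

(** * Subsequences and lower limits *)

Section Subsequences.

Lemma strict_incr_comp (phi psi : nat -> nat) :
  strict_incr phi -> strict_incr psi -> strict_incr (phi \o psi).
Proof. by move=> hphi hpsi m n mn; apply/hphi/hpsi. Qed.

Lemma strict_incr_cvg (phi : nat -> nat) : strict_incr phi ->
  phi @ \oo --> \oo.
Proof.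
move=> hphi; have le n : (n <= phi n)%N.
  by elim: n => // n IH; exact: leq_ltn_trans IH (hphi _ _ (ltnSn n)).
move=> A [N _ hN]; exists N => // n /= Nn; apply: hN => /=.
exact: leq_trans Nn (le n).
Qed.

Lemma cvg_subseq {T : topologicalType} (u : nat -> T) (l : T) phi :
  strict_incr phi -> u @ \oo --> l -> (u \o phi) @ \oo --> l.
Proof. by move=> /strict_incr_cvg; exact: cvg_comp. Qed.

(** Recursive choice: the index for [k + 1] is sought from one past the index for [k], which forces
    strict increase. *)
Lemma subseq_choice (P : nat -> nat -> Prop) :
  (forall k N, exists n, (N <= n)%N /\ P k n) ->
  exists phi, strict_incr phi /\ forall k, P k (phi k).
Proof.
move=> h; have [g hg] := choice (fun kN => h kN.1 kN.2).
pose phi := fix phi k := if k is j.+1 then g (k, (phi j).+1) else g (0, 0)%N.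
exists phi; split; last by case=> [|k]; apply: (hg (_, _)).2.
have step k : (phi k < phi k.+1)%N by apply: (hg (_, _)).1.
by move=> m n; apply: (homo_ltn ltn_trans step).
Qed.

(** The lower limit is the supremum of the tail infima, so some tail infimum exceeds [a - e]. *)
Lemma limn_einf_ge_near {R : realType} (u : nat -> R) (a e : R) :
  (a%:E <= limn_einf (EFin \o u))%E -> 0 < e ->
  exists N, forall n, (N <= n)%N -> a - e < u n.
Proof.
move=> ha e0; have : ((a - e)%:E < limn_einf (EFin \o u))%E.
  by apply: lt_le_trans ha; rewrite lte_fin; lra.
rewrite limn_einf_lim (cvg_lim _ (@cvg_einfs_sup _ _)) //.
move=> /ereal_sup_gt[_ [N _ <-] hN]; exists N => n Nn.
rewrite -lte_fin (lt_le_trans hN) //.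
by apply: ereal_inf_lbound; exists n.
Qed.

End Subsequences.

(** * Relative compactness and identification of the limits *)

Theorem theorem3p8 (R : realType) (dm : measure_display) (X : measurableType dm)
  (dist : X -> X -> R)
  (Hmetric : is_metric dist) (Hborel : borel_of_metric dist)
  (Hsep : separable dist) (Hweak : admits_weak_convergence dist)
  (p : R) (hp : 1 <= p)
  (mun : nat -> probability X R) (mu : probability X R)
  (Hmun : forall n, in_Pr dist (p - 1) (mun n)) (Hmu : in_Pr dist (p - 1) mu)
  (Hconv : tau_w_conv dist (p - 1) mun mu)
  (eps : nat -> R) (Heps0 : forall n, 0 <= eps n)
  (Heps : eps @ \oo --> (0 : R))
  (xs : nat -> X) (Hxs : forall n, Mp_eps dist p (mun n) (eps n) (xs n)) :
  (forall phi, strict_incr phi ->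
     exists psi x, strict_incr psi /\ dconv dist (xs \o phi \o psi) x) /\
  (forall phi x, strict_incr phi -> dconv dist (xs \o phi) x ->
     Mp dist p mu x).
Proof.
have [w [[_ wsub] W1 W2 W3]] := Hweak.
have sub phi (hphi : strict_incr phi) :
    tau_w_conv dist (p - 1) (mun \o phi) mu /\ (eps \o phi) @ \oo --> (0 : R).
  split; last exact: (cvg_subseq eps).
  split=> [f cf bf|x]; [have := Hconv.1 f cf bf|have := Hconv.2 x];
    exact: (cvg_subseq (fun n => \int[mun n]_y _)).
have Hs (phi : nat -> nat) n : Mp_eps dist p ((mun \o phi) n) ((eps \o phi) n) ((xs \o phi) n).
  exact: Hxs.
have bnd x : exists M, forall n, dist (xs n) x <= M.
  exact: (dist_bounded dist Hmetric Hborel p hp mun mu Hmun Hmu Hconv eps).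
split=> [phi hphi|phi x hphi hx x'].
  have [M hM] := bnd (xs 0%N).
  (* Boundedness and (W1) give a weakly convergent subsequence, along which all hypotheses
     persist. *)
  have [phi1 [x [hphi1 wx]]] :=
    W1 (xs \o phi) (xs 0%N) (ex_intro _ M (fun n => hM (phi n))).
  have hphi' := strict_incr_comp _ _ hphi hphi1.
  have [cmu ceps] := sub _ hphi'.
  have [y hy] := liminf_dist_attained dist Hmetric Hborel p hp _ mu
    (fun n => Hmun _) Hmu cmu _ _ ceps (Hs (phi \o phi1)) x.
  have [|psi [hpsi hle]] := subseq_choice (fun k n =>
      dist ((xs \o (phi \o phi1)) n) y < dist x y + k.+1%:R^-1).
    move=> k N; have e0 : 0 < k.+1%:R^-1 :> R by rewrite invr_gt0.
    by have [n Nn hn] := hy N _ e0; exists n.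
  exists (phi1 \o psi), x; split; first exact: strict_incr_comp.
  have wpsi := wsub _ _ _ wx hpsi.
  (* (W3) asks for convergence of the distances to [y]: the lower bound is (W2), the upper one is
     the choice of [psi]. *)
  apply: (W3 _ _ wpsi y); apply/cvgrPdist_lt => e e0.
  have [N hN] := limn_einf_ge_near (fun n => dist _ y) _ e (W2 _ _ wpsi y) e0.
  have he := cvgr_lt _ (@cvg_harmonic R) _ e0.
  near=> k.
  have h1 : dist x y - e < dist ((xs \o phi \o phi1 \o psi) k) y.
    by apply: hN; near: k; exact: nbhs_infty_ge.
  have h2 := hle k.
  have h3 : k.+1%:R^-1 < e by near: k; exact: he.
  rewrite ltr_norml; move: h1 h2 h3; rewrite /comp /=.
  set a := dist _ y; set b := dist x y; set c := _^-1 => h1 h2 h3.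
  by apply/andP; split; lra.
have [cmu ceps] := sub _ hphi.
have [M hM] := bnd x'.
(* Along a [d]-convergent subsequence the tail infima tend to [dist x], so the key inequality at
   [x'] reads [Wp p mu x x' <= 0]. *)
exact: (Rintegral_tail_inf_le0 dist Hmetric Hborel p hp _ mu (fun n => Hmun _)
  Hmu cmu _ _ ceps (Hs phi) x' M _ (fun n => hM (phi n))
  (tail_inf_cvg dist Hmetric _ x hx)).
Unshelve. all: by end_near. Qed.
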